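(* Let $k\ge 4$ be an integer. Then $\mathrm{URT}(k)\ge \frac{k-1}{k-2}$, and the longest word over $\Sigma_k=\{\mathtt{1},\dots,\mathtt{k}\}$ that is undirected $\frac{k-1}{k-2}$-free has length $k+3$.
   Context: For a word $x=x_1\cdots x_n$ (the $x_i$ letters), its reversal is $x^R=x_n\cdots x_1$. For a rational number $1<r\le 2$, an undirected $r$-power is a word of the form $xyx'$ where $x$ is a nonempty word, $x'\in\{x,x^R\}$, and $|xyx'|/|xy|=r$. A word $w$ is undirected $\alpha$-free if no factor of $w$ is an undirected $r$-power with $r\ge\alpha$. Undirected $\alpha$-powers are $k$-avoidable if there exists an infinite word over a $k$-letter alphabet that is undirected $\alpha$-free. The undirected repetition threshold is $\mathrm{URT}(k)=\inf\{r : \text{undirected } r\text{-powers are } k\text{-avoidable}\}$. *)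

(* Defs.v *)
From mathcomp Require Import all_boot all_order all_algebra.
From mathcomp Require Import classical_sets reals ereal.

Set Implicit Arguments.
Unset Strict Implicit.
Unset Printing Implicit Defensive.

Import Order.TTheory GRing.Theory Num.Theory.
Local Open Scope ring_scope.

(* A word over the alphabet T is a [seq T]; a (right-)infinite word is a
   function [nat -> T].  The k-letter alphabet {1, ..., k} is ['I_k], the
   ordinal i standing for the letter i + 1. *)

Definition undirected_power (T : Type) (r : rat) (w : seq T) : Prop :=
  1 < r <= 2 /\
  exists x y x' : seq T,
    [/\ x <> [::],
        x' = x \/ x' = rev x,
        w = x ++ y ++ x' &
        (size (x ++ y ++ x'))%:R / (size (x ++ y))%:R = r].

Definition undirected_free (R : realType) (alpha : R) (T : eqType)
    (w : seq T) : Prop :=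
  ~ exists (u : seq T) (r : rat),
      [/\ infix u w, undirected_power r u & alpha <= ratr r].

Definition infinite_factor (T : Type) (u : seq T) (w : nat -> T) : Prop :=
  exists i n : nat, u = mkseq (fun j => w (i + j)%N) n.

Definition infinite_undirected_free (R : realType) (alpha : R) (T : Type)
    (w : nat -> T) : Prop :=
  ~ exists (u : seq T) (r : rat),
      [/\ infinite_factor u w, undirected_power r u & alpha <= ratr r].

Definition k_avoidable (R : realType) (k : nat) (alpha : R) : Prop :=
  exists w : nat -> 'I_k, infinite_undirected_free alpha w.

(* By monotonicity of [k_avoidable] in its second argument and density of the
   rationals, letting r range over the reals of ]1, 2] gives the same infimum
   as letting it range over the rationals only. *)
Definition URT (R : realType) (k : nat) : \bar R :=
  ereal_inf [set r%:E | r in [set r : R | 1 < r <= 2 /\ k_avoidable k r]%classic]%classic.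

(* Main.v *)
Require Import Defs.
From mathcomp Require Import all_boot all_order all_algebra.
From mathcomp Require Import classical_sets reals ereal.
From mathcomp Require Import zify.

(** Write [f i] for the [i]-th letter of an undirected (k-1)/(k-2)-free word.
    Taking |x| = 1 shows that any k-1 consecutive letters are distinct, so equal
    letters are at distance at least k-1.  If [f a.+1 = f (a + k)], the pigeonhole
    principle applied to the positions a, ..., a+k-1 and a+k+1 leaves
    [f a = f (a + k).+1], which makes x = [f a; f a.+1] recur reversed, or two
    successive pairs at distance k-1, a repetition with |x| = 2.  Hence equal
    letters at distance k-1 occur only at the two ends of the word, and in between
    pigeonhole forces [f a = f (a + k)]; a word of length k+4 has room for two
    successive such [a], again a repetition with |x| = 2.  The word
    1 2 ... (k-1) 1 k 2 4 (with last letter 1 if k = 4) attains length k+3. *)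

Set Implicit Arguments.
Unset Strict Implicit.
Unset Printing Implicit Defensive.

Import Order.TTheory GRing.Theory Num.Theory.

(** * Freeness as arithmetic on positions *)

Section Repetitions.

Variables (R : realType) (k : nat).
Hypothesis k_ge4 : 4 <= k.

Local Notation alpha := ((k%:R - 1) / (k%:R - 2) : R)%R.

(** With m = |x| and p = |xy| the exponent is 1 + m/p, while [alpha] is 1 + 1/(k-2); clearing
    denominators leaves natural numbers only. *)
Lemma alpha_le_ratio (m p : nat) : 0 < p ->
  (alpha <= ratr ((p + m)%:R / p%:R))%R = (p <= (k - 2) * m).
Proof.
move=> p_gt0; rewrite fmorph_div !rmorph_nat.
have k2E : (k%:R - 2 = (k - 2)%:R :> R)%R by rewrite natrB //; lia.
have k1E : (k%:R - 1 = (k - 1)%:R :> R)%R by rewrite natrB //; lia.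
rewrite k1E k2E ler_pdivrMr ?ltr0n; last by lia.
rewrite mulrAC ler_pdivlMr ?ltr0n // -!natrM ler_nat.
by apply/idP/idP; nia.
Qed.

Lemma ratio_bounds (m p : nat) : 0 < m <= p ->
  (1 < (p + m)%:R / p%:R :> rat)%R && ((p + m)%:R / p%:R <= 2 :> rat)%R.
Proof.
case/andP=> m_gt0 le_mp; have p_gt0 : 0 < p by lia.
rewrite ltr_pdivlMr ?ltr0n // ler_pdivrMr ?ltr0n // mul1r -natrM ltr_nat ler_nat.
by apply/andP; split; lia.
Qed.

(** The working form of freeness: x starts at [i], x' at [i + p], and [m <= p] keeps them from
    overlapping, so that y has length p - m. *)
Lemma undirected_freeP (T : eqType) (w : seq T) :
  undirected_free alpha w <->
  forall i p m, 0 < m <= p -> i + p + m <= size w ->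
    let x := take m (drop i w) in let x' := take m (drop (i + p) w) in
    x' = x \/ x' = rev x -> (k - 2) * m < p.
Proof.
split=> [free_w i p m m_p le_w x x' xx' | free_w [u [r []]]].
  rewrite ltnNge; apply/negP => le_p; case: free_w.
  have size_x : size x = m by rewrite size_takel // size_drop; lia.
  have size_x' : size x' = m by rewrite size_takel // size_drop; lia.
  pose y := take (p - m) (drop (i + m) w).
  have size_xy : size (x ++ y) = p.
    by rewrite size_cat size_x size_takel ?size_drop; lia.
  exists (x ++ y ++ x'), ((p + m)%:R / p%:R)%R; split.
  - apply/infixP; exists (take i w), (drop (i + p + m) w).
    have -> : drop (i + p + m) w = drop m (drop (i + p) w).
      by rewrite drop_drop; congr drop; lia.
    rewrite -!catA cat_take_drop.
    have -> : drop (i + p) w = drop (p - m) (drop (i + m) w).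
      by rewrite drop_drop; congr drop; lia.
    rewrite cat_take_drop.
    have -> : drop (i + m) w = drop m (drop i w).
      by rewrite drop_drop; congr drop; lia.
    by rewrite !cat_take_drop.
  - split; first exact: ratio_bounds.
    exists x, y, x'; split=> //; first by move=> x0; rewrite x0 /= in size_x; lia.
    by rewrite catA size_cat size_xy size_x'.
  - by rewrite alpha_le_ratio //; lia.
case/infixP=> [s [t def_w]] [_] [x [y [x' [x_neq0 xx' def_u r_def]]]].
rewrite {}def_w {u}def_u in free_w *.
have size_x' : size x' = size x by case: xx' => ->; rewrite ?size_rev.
have size_x : 0 < size x by case: (x) x_neq0.
rewrite -{}r_def catA size_cat size_x'.
set p := size (x ++ y); have le_xp : size x <= p by rewrite /p size_cat leq_addr.
rewrite alpha_le_ratio; last by lia.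
apply/negP; rewrite -ltnNge; apply: (free_w (size s)); first by rewrite size_x.
  by rewrite !size_cat -/p; rewrite /p size_cat; lia.
rewrite -!catA (drop_size_cat _ (erefl (size s))) (take_size_cat _ (erefl (size x))).
suff -> : drop (size s + p) (s ++ x ++ y ++ x' ++ t) = x' ++ t.
  by rewrite take_size_cat.
by rewrite (catA x) catA drop_size_cat // size_cat.
Qed.

End Repetitions.

(** * Upper bound on the length of free words *)

Lemma pigeonhole_nat (k : nat) (g : nat -> 'I_k) :
  exists i j, i < j <= k /\ g i = g j.
Proof.
have /injectivePn[i [j neq_ij eq_g]] : ~~ injectiveb (fun i : 'I_k.+1 => g i).
  by apply/injectiveP => /leq_card; rewrite !card_ord ltnn.
have := ltn_ord i; have := ltn_ord j.
case: (ltngtP i j) => [lt_ij|lt_ji|/val_inj eq_ij] j_k i_k.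
- by exists i, j; split=> //; lia.
- by exists j, i; split=> //; lia.
- by rewrite eq_ij eqxx in neq_ij.
Qed.

Section UpperBound.

Variables (R : realType) (k : nat) (x0 : 'I_k) (w : seq 'I_k).
Hypothesis k_ge4 : 4 <= k.
Hypothesis free_w : undirected_free ((k%:R - 1) / (k%:R - 2) : R)%R w.

Local Notation f := (nth x0 w).

Lemma free_repetition i p m : 0 < m <= p -> i + p + m <= size w ->
  take m (drop (i + p) w) = take m (drop i w) \/
  take m (drop (i + p) w) = rev (take m (drop i w)) -> (k - 2) * m < p.
Proof. by have [free_rep _] := undirected_freeP R k_ge4 w; exact: free_rep. Qed.

Lemma take1_drop i : i < size w -> take 1 (drop i w) = [:: f i].
Proof. by move=> lt_i; rewrite (drop_nth x0) //= take0. Qed.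

Lemma take2_drop i : i.+1 < size w -> take 2 (drop i w) = [:: f i; f i.+1].
Proof.
by move=> lt_i; rewrite (drop_nth x0) 1?(drop_nth x0 (n := i.+1)) //= ?take0 //; lia.
Qed.

Lemma free_letters i j : i < j -> f i = f j -> j < size w -> k - 1 <= j - i.
Proof.
move=> lt_ij eq_f lt_j.
have : (k - 2) * 1 < j - i; last by lia.
apply: (@free_repetition i); [lia | lia |].
rewrite subnKC; last exact: ltnW.
by rewrite !take1_drop ?eq_f; [left | lia..].
Qed.

(** The case |x| = 2, for both orders of x'. It serves for p = k - 1 and p = k; the latter is
    admissible exactly when k >= 4. *)
Lemma free_pairs i p : 2 <= p <= 2 * (k - 2) -> i + p + 1 < size w ->
  ~ (f i = f (i + p) /\ f i.+1 = f (i + p).+1)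
  /\ ~ (f i = f (i + p).+1 /\ f i.+1 = f (i + p)).
Proof.
move=> p_bd lt_w.
have no_rep : ~ (take 2 (drop (i + p) w) = take 2 (drop i w) \/
                 take 2 (drop (i + p) w) = rev (take 2 (drop i w))).
  by move/free_repetition => /(_ ltac:(lia) ltac:(lia)); lia.
rewrite !take2_drop in no_rep; [|lia..].
by split=> -[eq1 eq2]; apply: no_rep; [left|right]; rewrite eq1 eq2.
Qed.

(** Two of the k + 1 letters from [a] on agree, and they are at least k - 1 apart; only three pairs
    of positions in the window are. *)
Lemma free_window a : a + k < size w ->
  [\/ f a = f (a + k - 1), f a.+1 = f (a + k) | f a = f (a + k)].
Proof.
move=> lt_w; have [i [j [ij_k eq_f]]] := pigeonhole_nat (fun i => f (a + i)).
have : k - 1 <= a + j - (a + i) by apply: free_letters => //; lia.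
rewrite subnDl => le_ij.
have [/eqP i0|i0] := boolP (i == 0); last first.
  have [i1 jk] : i = 1 /\ j = k by lia.
  by apply: Or32; rewrite i1 jk addn1 in eq_f.
have [/eqP jk|jk] := boolP (j == k).
  by apply: Or33; rewrite jk i0 addn0 in eq_f.
apply: Or31; have -> : a + k - 1 = a + j by lia.
by rewrite -eq_f i0 addn0.
Qed.

Lemma free_distance_pred a : (a + k).+1 < size w -> f a.+1 <> f (a + k).
Proof.
move=> lt_w eq1.
(* Position a + k is skipped, since by [eq1] its letter already stands at a + 1. *)
pose h i := if i < k then a + i else (a + k).+1.
have [i [j [ij_k eq_f]]] := pigeonhole_nat (fun i => f (h i)).
have h_lt l : l < k -> h l = a + l by move=> lt_l; rewrite /h lt_l.
rewrite (h_lt i) in eq_f; last by lia.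
have [jk|jk] := ltnP j k.
  rewrite h_lt // in eq_f.
  have le_ij : k - 1 <= a + j - (a + i) by apply: free_letters => //; lia.
  have [i0 j1] : i = 0 /\ j = k - 1 by lia.
  rewrite i0 addn0 j1 in eq_f.
  have [|//|no_rep _] := @free_pairs a (k - 1); [lia | lia |].
  by apply: no_rep; split; rewrite // eq1; congr f; lia.
have j_k : j = k by lia.
rewrite j_k /h ltnn in eq_f.
have le_i : k - 1 <= (a + k).+1 - (a + i) by apply: free_letters => //; lia.
(* The distance bound leaves i <= 2. For i = 0 the pair at a recurs reversed at distance k; for i =
   1 the letters at a + k and a + k + 1 agree; for i = 2 the pair at a + 1 recurs at distance k -
   1. *)
case: i ij_k eq_f le_i => [|[|i]] ij_k eq_f le_i.
- have [||_] := @free_pairs a k; [lia | lia |].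
  by case; rewrite -eq_f addn0.
- suff : k - 1 <= (a + k).+1 - (a + k) by lia.
  by apply: free_letters; rewrite -?eq1 -?eq_f ?addn1.
- have i0 : i = 0 by lia.
  have [||no_rep _] := @free_pairs a.+1 (k - 1); [lia | lia |].
  have e : a.+1 + (k - 1) = a + k by lia.
  by apply: no_rep; rewrite e; split; rewrite // -eq_f i0 addn2.
Qed.

Lemma free_size : size w <= k + 3.
Proof.
rewrite leqNgt; apply/negP => lt_w.
(* [free_distance_pred] at a - 1 and at a excludes the other two cases of the window; length k + 4
   leaves room for this when a is 1 or 2. *)
have inner a : 0 < a < 3 -> f a = f (a + k).
  move=> a_bd; case: (@free_window a) => [|eqE|eqE|//]; first by lia.
    case: (@free_distance_pred a.-1); first by lia.
    by rewrite prednK; [rewrite eqE; congr f; lia | lia].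
  by case: (@free_distance_pred a); first by lia.
have [||no_rep _] := @free_pairs 1 k; [lia | lia |].
by apply: no_rep; split; [exact: inner | exact: (inner 2)].
Qed.

End UpperBound.

(** * A free word of length k + 3 *)

Section Extremal.

Variables (R : realType) (k : nat).
Hypothesis k_ge4 : 4 <= k.

(** Letters are counted from 0. For k = 4 the last letter cannot be 3, which stands two positions
    earlier. *)
Definition extremal_letter (i : nat) : nat :=
  if i < k - 1 then i else if i == k - 1 then 0 else if i == k then k - 1
  else if i == k.+1 then 1 else if k == 4 then 0 else 3.

Lemma extremal_letterE i :
  i < k - 1 /\ extremal_letter i = i \/ i = k - 1 /\ extremal_letter i = 0 \/
  i = k /\ extremal_letter i = k - 1 \/ i = k.+1 /\ extremal_letter i = 1 \/
  k.+1 < i /\ k = 4 /\ extremal_letter i = 0 \/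
  k.+1 < i /\ 4 < k /\ extremal_letter i = 3.
Proof.
by rewrite /extremal_letter; case: ltnP => ?; do 4?[case: eqP => ?]; lia.
Qed.

Lemma extremal_letter_lt i : extremal_letter i < k.
Proof. by have := extremal_letterE i; lia. Qed.

(** Every coincidence in the word is covered. The only consecutive starting positions are 0 and 1,
    with different distances, so no pair of letters recurs unreversed. *)
Lemma extremal_letter_eq i j :
  i < j < k + 3 -> extremal_letter i = extremal_letter j ->
  i = 0 /\ j = k - 1 \/ i = 1 /\ j = k.+1 \/ i = 3 /\ j = k.+2 \/
  k = 4 /\ i = 0 /\ j = 6.
Proof. by have := extremal_letterE i; have := extremal_letterE j; lia. Qed.

Definition extremal_word : seq 'I_k :=
  mkseq (fun i => Ordinal (extremal_letter_lt i)) (k + 3).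

Lemma extremal_word_free :
  undirected_free ((k%:R - 1) / (k%:R - 2) : R)%R extremal_word.
Proof.
apply/undirected_freeP => // i p m m_p; rewrite size_mkseq => le_w /= xx'.
pose f i := Ordinal (extremal_letter_lt i).
have x0 : 'I_k := f 0.
have nthE j l : l < m -> j + m <= k + 3 ->
    nth x0 (take m (drop j extremal_word)) l = f (j + l).
  by move=> lt_l le_j; rewrite nth_take // nth_drop nth_mkseq //; lia.
have size_x : size (take m (drop i extremal_word)) = m.
  by rewrite size_takel // size_drop size_mkseq; lia.
rewrite ltnNge; apply/negP => p_le; case: xx' => eq_x.
  have eq_f l : l < m -> extremal_letter (i + l) = extremal_letter (i + p + l).
    move=> lt_l; have := congr1 (fun s => val (nth x0 s l)) eq_x.
    by rewrite !nthE /=; lia.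
  have := @extremal_letter_eq _ _ _ (eq_f 0 ltac:(lia)).
  have [m1|m_gt1] : m = 1 \/ 1 < m by lia.
    by rewrite m1 in p_le *; lia.
  by have := @extremal_letter_eq _ _ _ (eq_f 1 m_gt1); lia.
(* Here l = 0 matches the last letter of x with the first of x', and growing l moves outwards. *)
have eq_f l : l < m ->
    extremal_letter (i + (m - l.+1)) = extremal_letter (i + p + l).
  move=> lt_l; have := congr1 (fun s => val (nth x0 s l)) eq_x.
  by rewrite nth_rev size_x // !nthE /=; lia.
(* The two innermost coincidences suffice: only for k = 4 does the word contain
   ab...ba, namely at both of its ends, too far apart to be forbidden. *)
have := @extremal_letter_eq _ _ _ (eq_f 0 ltac:(lia)).
have [m1|m_gt1] : m = 1 \/ 1 < m by lia.
  by rewrite m1 in p_le *; lia.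
have := @extremal_letter_eq _ _ _ (eq_f 1 m_gt1).
have [m2|m_gt2] : m = 2 \/ 2 < m by lia.
  by rewrite m2 in p_le *; lia.
by lia.
Qed.

End Extremal.

(** * From infinite words to the bound on the threshold *)

Lemma infinite_free_prefix (R : realType) (alpha beta : R) (T : eqType)
    (w : nat -> T) (n : nat) :
  (alpha <= beta)%R -> infinite_undirected_free alpha w ->
  undirected_free beta (mkseq w n).
Proof.
move=> le_ab free_w [u [r [/infixP[s [t def_w]] pow_u le_br]]].
apply: free_w; exists u, r; split=> //; last exact: le_trans le_br.
exists (size s), (size u); have size_w := congr1 size def_w.
rewrite size_mkseq !size_cat in size_w.
apply: (@eq_from_nth _ (w 0)); rewrite ?size_mkseq // => i lt_i.
rewrite nth_mkseq // -(@nth_mkseq _ (w 0) w n (size s + i)); last by lia.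
by rewrite def_w nth_cat ltnNge leq_addr /= addKn nth_cat lt_i.
Qed.

Theorem theorem3 (R : realType) (k : nat) (hk : (4 <= k)%N) :
  ((((k%:R - 1) / (k%:R - 2))%R : R)%:E <= URT R k)%E /\
  (exists2 w : seq 'I_k,
     undirected_free ((k%:R - 1) / (k%:R - 2) : R)%R w & size w = (k + 3)%N) /\
  (forall w : seq 'I_k,
     undirected_free ((k%:R - 1) / (k%:R - 2) : R)%R w -> (size w <= k + 3)%N).
Proof.
have x0 : 'I_k by exists 0; lia.
split; last split=> [|w]; last exact: free_size.
  apply: le_ereal_inf_tmp => _ [r [_ [w free_w]] <-].
  rewrite lee_fin leNgt; apply/negP => /ltW lt_r.
  (* An avoidable [r] below the bound would yield a free prefix one letter too long. *)
  have := free_size x0 hk (infinite_free_prefix (n := k + 4) lt_r free_w).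
  by rewrite size_mkseq; lia.
by exists (extremal_word hk); [exact: extremal_word_free | rewrite size_mkseq].
Qed.
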